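(* For $T>0$, let $\sigma_1(T)=\sup_{f\in\mathcal{L}_2(T)}\int_0^T|f'(t)|\,dt$. For every $N\in\mathbb{N}=\{0,1,2,\dots\}$, $$\sigma_1\bigl(2N\sqrt2+4\bigr)=2N+4.$$
   Context: For $T>0$, $\mathcal{L}_2(T)$ is the set of functions $f:[0,T]\to\mathbb{R}$ that are differentiable on $[0,T]$ (one-sided at the endpoints), with $f'$ absolutely continuous, such that $|f(t)|\le 1$ for all $t\in[0,T]$ and $|f''(t)|\le 1$ for almost every $t\in[0,T]$ (equivalently, $|f|\le1$ and $f'$ is $1$-Lipschitz). *)

(* Defs.v *)
From HB Require Import structures.
From mathcomp Require Export all_boot all_order all_algebra.
From mathcomp Require Export all_classical all_reals all_analysis.

Set Implicit Arguments.
Unset Strict Implicit.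
Unset Printing Implicit Defensive.

Import Order.TTheory GRing.Theory Num.Theory.
Import numFieldNormedType.Exports.

Local Open Scope classical_set_scope.
Local Open Scope ring_scope.

Definition diff_quot (R : realType) (f : R -> R) (x y : R) : R :=
  (f y - f x) / (y - x).

(* Points of `[a, b] tending to x while remaining different from x: two-sided
   for a < x < b, one-sided at x = a and x = b. *)
Definition punctured (R : realType) (a b x : R) : set_system R :=
  within `[a, b] (x^').

Definition derivable_on (R : realType) (a b : R) (f : R -> R) (x : R) : Prop :=
  cvg (diff_quot f x y @[y --> punctured a b x]).

(* Depends only on the values of f on `[a, b]; meaningful at x in `[a, b]
   only when derivable_on a b f x holds. *)
Definition deriv_on (R : realType) (a b : R) (f : R -> R) (x : R) : R :=
  lim (diff_quot f x y @[y --> punctured a b x]).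

Definition abs_continuous_on (R : realType) (a b : R) (f : R -> R) : Prop :=
  forall e : R, 0 < e -> exists2 d : R, 0 < d &
    forall (n : nat) (u v : 'I_n -> R),
      (forall i, a <= u i <= v i /\ v i <= b) ->
      trivIset [set: 'I_n] (fun i => [set` `]u i, v i[]) ->
      \sum_(i < n) (v i - u i) < d ->
      \sum_(i < n) `|f (v i) - f (u i)| < e.

(* A function on [0, T] is represented by any of its extensions to R; only its
   restriction to `[0, T] matters. *)
Definition L2class (R : realType) (T : R) (f : R -> R) : Prop :=
  [/\ forall t, t \in `[0, T] -> derivable_on 0 T f t,
      abs_continuous_on 0 T (deriv_on 0 T f),
      forall t, t \in `[0, T] -> `|f t| <= 1 &
      {ae (@lebesgue_measure R), forall t, t \in `[0, T] ->
         derivable_on 0 T (deriv_on 0 T f) t /\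
         `|deriv_on 0 T (deriv_on 0 T f) t| <= 1}].

Definition sigma1 (R : realType) (T : R) : \bar R :=
  ereal_sup [set (\int[@lebesgue_measure R]_(t in `[0%R, T])
                    (`|deriv_on 0 T f t|%R)%:E)%E | f in L2class T].

(* Main.v *)
Require Import Defs.
From mathcomp Require Import ring lra.
Set Implicit Arguments.
Unset Strict Implicit.
Unset Printing Implicit Defensive.
Import Order.TTheory GRing.Theory Num.Theory.
Import numFieldNormedType.Exports.
Local Open Scope classical_set_scope.
Local Open Scope ring_scope.

(* Upper bound.  Put [g := f']; it is absolutely continuous with [|g'| <= 1]
   almost everywhere, hence 1-Lipschitz.  On an interval of length [d] between
   consecutive zeros of [g], [f] is monotone and its variation is at most
   [min(2, d^2 / 4) <= d / sqrt 2].  Before the first zero (at [a]) and after the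
   last one (at [T - b]) it is at most [min(2, a^2 / 2) <= min(2, a)] and
   [min(2, b)].  Adding up, for [T >= 4] the total variation is at most
   [min(4, a + b) + (T - a - b) / sqrt 2 <= 4 + (T - 4) / sqrt 2].

   Lower bound.  The extremal function has [f'' = 1] or [-1] on successive
   intervals: it starts at [-1] with speed [2], reaches [1] at rest after time
   [2], swings [N] times between [1] and [-1] from rest to rest, each swing
   taking time [2 sqrt 2], and leaves with constant acceleration for a last
   time [2]. *)

(** * Slopes relative to an interval *)

(** Real induction through the supremum of the good points. A step straddles [x], so the same
    hypothesis shows that the supremum is good and carries [P] beyond it. *)
Lemma interval_induction (R : realType) (a b : R) (P : R -> Prop) :
  a <= b -> P a ->
  (forall x, a <= x <= b -> exists2 d, 0 < d &
     forall y z, a <= y <= x -> x <= z <= b -> z - y < d -> P y -> P z) ->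
  P b.
Proof.
move=> ab Pa step; pose S : set R := [set x | a <= x <= b /\ P x].
have Sa : S a by split=> //; rewrite lexx.
have ubS : ubound S b by move=> x [/andP[]].
have supS : has_sup S by split; [exists a|exists b].
set s := sup S.
have as_ : a <= s by apply: ub_le_sup => //; exists b.
have sb : s <= b by apply: ge_sup => //; exists a.
have /step[d d0 Pd] : a <= s <= b by rewrite as_.
have d20 : 0 < d / 2 by rewrite divr_gt0.
have [y [/andP[ay yb] Py] sy] := sup_adherent d20 supS.
have ys : y <= s by apply: ub_le_sup => //; [exists b|split=> //; rewrite ay].
rewrite -/s in sy.
have Pz z : s <= z <= b -> z < s + d / 2 -> P z.
  by move=> szb zd; apply: (Pd y) => //; [rewrite ay ys|lra].
have [bs|sb'] := leP b s; first by apply: Pz; lra.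
pose z := Num.min b (s + d / 4).
have zb : z <= b by rewrite ge_min lexx.
have sz : s < z by rewrite lt_min sb' ltrDl divr_gt0.
have zd : z <= s + d / 4 by rewrite ge_min lexx orbT.
have : z <= s.
  apply: ub_le_sup; first by exists b.
  split; first by rewrite zb andbT; lra.
  by apply: Pz; [rewrite zb ltW|lra].
by rewrite leNgt sz.
Qed.

(** Derivative relative to [[a, b]], multiplied out so that [y = x] needs no separate treatment;
    [has_slopeP] links it to the limit of difference quotients. *)
Definition has_slope (R : realType) (a b : R) (f : R -> R) (x l : R) : Prop :=
  forall e, 0 < e -> exists2 d, 0 < d &
    forall y, a <= y <= b -> `|y - x| < d ->
      `|f y - f x - l * (y - x)| <= e * `|y - x|.

Lemma has_slope_sub (R : realType) (a b a' b' : R) f x l :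
  a' <= a -> b <= b' -> @has_slope R a' b' f x l -> has_slope a b f x l.
Proof.
move=> aa bb fl e /fl[d d0 fd]; exists d => // y ayb; apply: fd.
by move: ayb; lra.
Qed.

Lemma has_slopeD (R : realType) (a b : R) f g x l m :
  has_slope a b f x l -> has_slope a b g x m ->
  @has_slope R a b (fun t => f t + g t) x (l + m).
Proof.
move=> fl gm e e0; have e20 : 0 < e / 2 by rewrite divr_gt0.
have [d d0 fd] := fl _ e20; have [d' d0' gd] := gm _ e20.
exists (Num.min d d'); first by rewrite lt_min d0.
move=> y ayb; rewrite lt_min => /andP[/(fd _ ayb) h1 /(gd _ ayb) h2].
rewrite (_ : _ - _ = (f y - f x - l * (y - x)) + (g y - g x - m * (y - x)));
  last by ring.
by rewrite (le_trans (ler_normD _ _))//; lra.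
Qed.

Lemma has_slopeN (R : realType) (a b : R) f x l :
  has_slope a b f x l -> @has_slope R a b (fun t => - f t) x (- l).
Proof.
move=> fl e /fl[d d0 fd]; exists d => // y ayb /(fd _ ayb).
by rewrite -normrN; congr (`|_| <= _); ring.
Qed.

Lemma has_slope_quadratic (R : realType) (a b c u v w x : R) :
  @has_slope R a b (fun t => u * (t - c) ^+ 2 + v * t + w) x
    (2 * u * (x - c) + v).
Proof.
move=> e e0; exists (e / (`|u| + 1)).
  by rewrite divr_gt0// ltr_wpDl.
move=> y _ yx; rewrite (_ : _ - _ - _ = u * (y - x) * (y - x)); last by ring.
rewrite normrM ler_wpM2r// normrM.
move: yx; rewrite ltr_pdivlMr ?ltr_wpDl// => yx.
rewrite (le_trans _ (ltW yx))// mulrC ler_wpM2l//; lra.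
Qed.

(** Comparison principle behind all later estimates. Across any point, [f - g] has slope at most 0,
    so over short steps it grows by at most [e] times the length; interval induction adds these
    steps up, and [e] is arbitrary. *)
Lemma slope_le_increment (R : realType) (a b : R) (f g l m : R -> R) : a <= b ->
  (forall x, a <= x <= b -> has_slope a b f x (l x)) ->
  (forall x, a <= x <= b -> has_slope a b g x (m x)) ->
  (forall x, a <= x <= b -> l x <= m x) ->
  f b - f a <= g b - g a.
Proof.
move=> ab fl gm lm.
suff H e : 0 < e -> f b - f a <= g b - g a + e * (b - a).
  apply/ler_addgt0Pr => e e0.
  have ba : 0 < b - a + 1 by lra.
  apply: le_trans (H (e / (b - a + 1)) _) _; first by rewrite divr_gt0.
  rewrite lerD2l -mulrA ger_pMr// mulrC ler_pdivrMr//; lra.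
move=> e0; pose P x := f x - f a <= g x - g a + e * (x - a).
apply: (@interval_induction _ a b P) => //.
  by rewrite /P !subrr mulr0 addr0.
move=> x axb.
have [d d0 hd] := has_slopeD (fl _ axb) (has_slopeN (gm _ axb)) e0.
exists d => // y z ayx xzb zyd; rewrite /P => IH.
have lmx := lm _ axb.
have := hd y; have := hd z.
rewrite (ger0_norm (_ : 0 <= z - x)); last by lra.
rewrite (ler0_norm (_ : y - x <= 0)); last by lra.
move=> /(_ ltac:(lra) ltac:(lra)) /ler_normlP[_ h1].
move=> /(_ ltac:(lra) ltac:(lra)) /ler_normlP[h2 _].
have h3 : (l x - m x) * (z - x) <= 0 by rewrite mulr_le0_ge0//; lra.
have h4 : (l x - m x) * (x - y) <= 0 by rewrite mulr_le0_ge0//; lra.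
nra.
Qed.

Lemma near_punctured (R : realType) (a b x : R) (P : R -> Prop) :
  (\forall y \near punctured a b x, P y) <->
  exists2 d, 0 < d &
    forall y, a <= y <= b -> y != x -> `|y - x| < d -> P y.
Proof.
split.
  move=> /nbhs_ballP[d d0 H]; exists d => // y ayb yx yd.
  by apply: H; [rewrite /ball/= distrC| |rewrite /= in_itv].
move=> [d d0 H]; apply/nbhs_ballP; exists d => // y /= + yx.
by rewrite in_itv/= => xyd ayb; apply: H => //; rewrite distrC.
Qed.

(** Properness makes the limit unique, so that [deriv_on] can be computed from a known slope. The
    witness is taken to the right of [x], or to the left when [x = b]. *)
Lemma punctured_proper (R : realType) (a b x : R) : a < b -> a <= x <= b ->
  ProperFilter (punctured a b x).
Proof.
move=> ab axb; apply: Build_ProperFilter_ex => P /near_punctured[d d0 H].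
have [xb|bx] := ltP x b.
  exists (Num.min b (x + d / 2)).
  have m : Num.min b (x + d / 2) <= b by rewrite ge_min lexx.
  have m' : Num.min b (x + d / 2) <= x + d / 2 by rewrite ge_min lexx orbT.
  have xm : x < Num.min b (x + d / 2) by rewrite lt_min xb ltrDl divr_gt0.
  apply: H; [lra| by rewrite gt_eqF|rewrite gtr0_norm; lra].
exists (Num.max a (x - d / 2)).
have m : a <= Num.max a (x - d / 2) by rewrite le_max lexx.
have m' : x - d / 2 <= Num.max a (x - d / 2) by rewrite le_max lexx orbT.
have xm : Num.max a (x - d / 2) < x by rewrite gt_max; lra.
apply: H; [lra| by rewrite lt_eqF|rewrite ltr0_norm; lra].
Qed.

Lemma diff_quot_dist (R : realType) (f : R -> R) (x y l : R) : y != x ->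
  `|f y - f x - l * (y - x)| = `|l - diff_quot f x y| * `|y - x|.
Proof.
move=> yx; rewrite -normrM distrC; congr `|_|.
by rewrite mulrBl /diff_quot divfK// subr_eq0.
Qed.

Lemma has_slopeP (R : realType) (a b : R) f x l :
  diff_quot f x y @[y --> punctured a b x] --> l <-> has_slope a b f x l.
Proof.
split=> [fl e e0|fl].
  move/cvgrPdist_le : fl => /(_ _ e0)/near_punctured[d d0 H].
  exists d => // y ayb yd.
  have [->|yx] := eqVneq y x; first by rewrite !subrr mulr0 subrr normr0 mulr0.
  by rewrite diff_quot_dist// ler_wpM2r// H.
apply/cvgrPdist_le => e /fl[d d0 H]; apply/near_punctured; exists d => //.
move=> y ayb yx yd; have := H y ayb yd.
by rewrite diff_quot_dist// ler_pM2r// normr_gt0 subr_eq0.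
Qed.

Lemma derivable_on_slope (R : realType) (a b : R) f x :
  derivable_on a b f x -> has_slope a b f x (deriv_on a b f x).
Proof. by move=> ?; apply/has_slopeP. Qed.

Lemma slope_derivable_on (R : realType) (a b : R) f x l :
  has_slope a b f x l -> derivable_on a b f x.
Proof. by move=> /has_slopeP fl; apply/cvg_ex; exists l. Qed.

Lemma slope_deriv_on (R : realType) (a b : R) f x l :
  a < b -> a <= x <= b -> has_slope a b f x l -> deriv_on a b f x = l.
Proof.
move=> ab axb /has_slopeP fl.
have ? := punctured_proper ab axb.
exact: cvg_lim.
Qed.

(** * Absolutely continuous functions with derivative bounded by one *)

(** Absolute continuity for lists of intervals ordered from right to left, so that an induction
    moving rightwards can add its newest interval at the head. *)
Lemma abs_continuous_seq (R : realType) (a b : R) (g : R -> R) :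
  abs_continuous_on a b g -> forall e, 0 < e -> exists2 d, 0 < d &
  forall s : seq (R * R), {in s, forall p, a <= p.1 <= p.2 /\ p.2 <= b} ->
    pairwise (fun p q => q.2 <= p.1) s ->
    \sum_(p <- s) (p.2 - p.1) < d ->
    \sum_(p <- s) `|g p.2 - g p.1| < e.
Proof.
move=> gac e e0; have [d d0 H] := gac e e0; exists d => // s sab sp sd.
rewrite (big_nth (0, 0)) big_mkord.
apply: (H _ (fun i => (nth (0, 0) s i).1) (fun i => (nth (0, 0) s i).2)).
- by move=> i; apply: sab; rewrite mem_nth.
- move=> i j _ _ [t [/=]]; rewrite !in_itv/= => ti tj; apply/val_inj/eqP.
  have sep k l : (k < l < size s)%N -> (nth (0, 0) s l).2 <= (nth (0, 0) s k).1.
    move=> /andP[kl ls].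
    by apply: (pairwiseP (0, 0) sp) => //; rewrite inE (ltn_trans kl).
  have [ij|ij|/eqP//] := ltngtP (val i) (val j).
    have := sep _ _ (introT andP (conj ij (ltn_ord j))); lra.
  have := sep _ _ (introT andP (conj ij (ltn_ord i))); lra.
- by move: sd; rewrite (big_nth (0, 0)) big_mkord.
Qed.

Lemma slope_increment_le (R : realType) (a b : R) (g : R -> R) x l e :
  0 < e -> `|l| <= 1 -> has_slope a b g x l -> exists2 d, 0 < d &
    forall y z, a <= y <= x -> x <= z <= b -> z - y < d ->
      `|g z - g y| <= (1 + e) * (z - y).
Proof.
move=> e0 l1 /(_ _ e0)[d d0 H]; exists d => // y z ayx xzb zyd.
have := H y ltac:(lra); rewrite ler0_norm ?subr_le0; last by lra.
move=> /(_ ltac:(lra)); move: (H z ltac:(lra)).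
rewrite ger0_norm ?subr_ge0; last by lra.
move=> /(_ ltac:(lra)) hz hy.
rewrite (_ : g z - g y = (g z - g x - l * (z - x)) - (g y - g x - l * (y - x))
   + l * (z - y)); last by ring.
rewrite (le_trans (ler_normD _ _))//.
rewrite (_ : (1 + e) * (z - y) = e * (z - y) + (z - y)); last by ring.
rewrite lerD//.
  by rewrite (le_trans (ler_normB _ _))//; lra.
by rewrite normrM [X in _ * X]ger0_norm ?subr_ge0 ?ler_piMl//; lra.
Qed.

(* Induction along [[a, b]]: near a good point the increment of [g] is at most
   [(1 + e) (z - y)]; the steps around the bad points lie in an open set [U] of
   measure less than [d], so absolute continuity makes their contribution less
   than [e]. *)
Lemma ae_slope_lipschitz (R : realType) (a b : R) (g l : R -> R) (N : set R) :
  a <= b -> abs_continuous_on a b g -> (@lebesgue_measure R).-negligible N ->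
  (forall x, a <= x <= b -> ~ N x -> has_slope a b g x (l x) /\ `|l x| <= 1) ->
  `|g b - g a| <= b - a.
Proof.
move=> ab gac [A [mA A0 NA]] gl.
suff H e : 0 < e -> `|g b - g a| <= (b - a) + e * (b - a + 1).
  apply/ler_addgt0Pr => e e0.
  have ba : 0 < b - a + 1 by lra.
  apply: le_trans (H (e / (b - a + 1)) _) _; first by rewrite divr_gt0.
  by rewrite divfK// gt_eqF.
move=> e0; have [d d0 Hd] := abs_continuous_seq gac e0.
pose mu : {measure set (measurableTypeR R) -> \bar R} := @lebesgue_measure R.
have muA : mu A = 0%E by exact: A0.
have [|U [oU AU UA]] := @lebesgue_regularity_outer R A d mA _ d0.
  by rewrite [ltLHS]muA ltry.
have mU : measurable U by exact: measurable_realfun.open_measurable.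
have muU : (mu U < d%:E)%E.
  rewrite (_ : mu U = mu (U `\` A))//.
  rewrite -[in LHS](setDUK AU) measureU//; last 2 first.
  - exact: measurableD.
  - by rewrite setDIK.
  by rewrite [X in (X + _)%E]muA add0e.
(* The list [s] records the steps made so far inside [U]. Its total length is charged to the part of
   [U] already passed, so at [b] it is below [d] and absolute continuity applies. *)
pose P x := exists s : seq (R * R),
  [/\ {in s, forall p, a <= p.1 <= p.2 /\ p.2 <= x},
      pairwise (fun p q => q.2 <= p.1) s,
      ((\sum_(p <- s) (p.2 - p.1))%:E <= mu (U `&` `]a, x]%classic))%E &
      `|g x - g a| <= (1 + e) * (x - a) + \sum_(p <- s) `|g p.2 - g p.1|].
suff [s [sb sp sU sg]] : P b.
  have /(Hd _ sb sp) : \sum_(p <- s) (p.2 - p.1) < d.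
    rewrite -lte_fin (le_lt_trans sU)// (le_lt_trans _ muU)//.
    apply: le_measure; rewrite ?inE//.
    exact: measurableI.
  move: sg; lra.
apply: (@interval_induction _ a b P) => //.
  by exists [::]; rewrite !big_nil !subrr normr0 mulr0 addr0; split=> //.
move=> x axb; have [Ux|Ux] := pselect (U x); last first.
  have Nx : ~ N x by move=> /NA/AU.
  have [hx lx] := gl x axb Nx.
  have [r r0 Hr] := slope_increment_le e0 lx hx.
  exists r => // y z ayx xzb zyr [s [sb sp sU sg]]; exists s; split=> //.
  - by move=> p /sb; lra.
  - rewrite (le_trans sU)//; apply: le_measure; rewrite ?inE//.
    + exact: measurableI.
    + exact: measurableI.
    + by apply: setIS; apply: subset_itvl; rewrite bnd_simp; lra.
  - have := Hr _ _ ayx xzb zyr; have := ler_distD (g y) (g z) (g a); lra.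
(* A step shorter than [r] around [x] stays inside [U], so the whole interval from [y] to [z] can be
   added to the list. *)
have /nbhs_ballP[r r0 Hr] : nbhs x U by exact: open_nbhs_nbhs.
exists r => // y z ayx xzb zyr [s [sb sp sU sg]].
exists ((y, z) :: s); split.
- by move=> p; rewrite inE => /predU1P[->/=|/sb]; lra.
- by rewrite /= sp andbT; apply/allP => p /sb /=; lra.
- rewrite big_cons/= EFinD.
  have yzE : (z - y)%:E = mu `]y, z]%classic.
    apply/esym; apply: etrans (lebesgue_measure_itv `]y, z]) _ => /=.
    by rewrite lte_fin; case: ltP => // zy; congr EFin; lra.
  rewrite yzE addeC (le_trans (leeD2r _ sU))// -measureU//; last 2 first.
  + exact: measurableI.
  + by apply/seteqP; split=> // t [[_ /=]]; rewrite !in_itv/=; lra.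
  apply: le_measure; rewrite ?inE//.
  + by apply: measurableU => //; exact: measurableI.
  + exact: measurableI.
  + move=> t [[Ut]|] /=; rewrite !in_itv/= => ht; split=> //; try lra.
    by apply: Hr; rewrite /ball/= ltr_norml; lra.
- rewrite big_cons /=.
  have := ler_distD (g y) (g z) (g a).
  have : 0 <= (1 + e) * (z - y) by rewrite mulr_ge0//; lra.
  move: sg; lra.
Qed.

(** * Variation of functions with nonexpansive slope *)

Definition nonexpansive_on (R : realType) (a b : R) (g : R -> R) : Prop :=
  forall x y, a <= x -> x <= y -> y <= b -> `|g y - g x| <= y - x.

Lemma nonexpansive_continuous (R : realType) (a b : R) (g : R -> R) :
  nonexpansive_on a b g -> {within `[a, b], continuous g}.
Proof.
move=> gl; apply/subspace_continuousP => x; rewrite /= in_itv/= => /andP[ax xb].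
apply/cvgrPdist_le => e e0; apply/nbhs_ballP; exists e => // y.
rewrite /ball/= in_itv/= => xye /andP[ay yb].
have [xy|/ltW yx] := leP x y.
  rewrite distrC (le_trans (gl _ _ ax xy yb))//.
  by move: xye; rewrite ler0_norm; lra.
rewrite (le_trans (gl _ _ ay yx xb))//.
by move: xye; rewrite ger0_norm; lra.
Qed.

Lemma nonexpansive_sub (R : realType) (a b a' b' : R) (g : R -> R) :
  a' <= a -> b <= b' -> nonexpansive_on a' b' g -> nonexpansive_on a b g.
Proof. by move=> aa bb gl x y ax xy yb; apply: gl => //; lra. Qed.

(** The infimum of the zeros is itself a zero: there are zeros within any [e] of it, and [g] is
    nonexpansive. *)
Lemma first_zero (R : realType) (a b : R) (g : R -> R) : a <= b ->
  nonexpansive_on a b g -> g b = 0 ->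
  exists z, [/\ a <= z <= b, g z = 0 & forall x, a <= x < z -> g x != 0].
Proof.
move=> ab gl gb; pose Z : set R := [set x | a <= x <= b /\ g x = 0].
have Zb : Z b by split=> //; rewrite lexx ab.
have lbZ : lbound Z a by move=> x [/andP[]].
have hZ : has_inf Z by split; [exists b|exists a].
have ai : a <= inf Z by apply: lb_le_inf => //; exists b.
have ib : inf Z <= b by apply: ge_inf => //; exists a.
exists (inf Z); split.
- by rewrite ai.
- apply/eqP; rewrite -normr_eq0 eq_le normr_ge0 andbT.
  apply/ler_addgt0Pr => e e0; rewrite add0r.
  have [y [/andP[ay yb] gy] yi] := inf_adherent e0 hZ.
  have iy : inf Z <= y by apply: ge_inf; [exists a|split=> //; rewrite ay].
  have := gl _ _ ai iy yb; rewrite gy sub0r normrN; lra.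
- move=> x /andP[ax xi]; apply/negP => /eqP gx.
  have : inf Z <= x.
    by apply: ge_inf; [exists a|split=> //; rewrite ax; lra].
  by rewrite leNgt xi.
Qed.

Lemma last_zero (R : realType) (a b : R) (g : R -> R) : a <= b ->
  nonexpansive_on a b g -> g a = 0 ->
  exists z, [/\ a <= z <= b, g z = 0 & forall x, z < x <= b -> g x != 0].
Proof.
move=> ab gl ga.
have [|||z [abz gz H]] := @first_zero R (- b) (- a) (g \o -%R).
- by rewrite lerN2.
- move=> x y bx xy ya /=; rewrite distrC.
  have := gl (- y) (- x) ltac:(lra) ltac:(lra) ltac:(lra); lra.
- by rewrite /= opprK.
exists (- z); split=> //; first by lra.
by move=> x zx; rewrite -(opprK x); apply: H; lra.
Qed.

(** Two points of strictly opposite signs would enclose a zero by the intermediate value theorem. It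
    differs from both, hence is interior; zeros at [a] and [b] are therefore allowed. *)
Lemma nonvanishing_sign (R : realType) (a b : R) (g : R -> R) :
  nonexpansive_on a b g -> (forall x, a < x < b -> g x != 0) ->
  (forall x, a <= x <= b -> 0 <= g x) \/ (forall x, a <= x <= b -> g x <= 0).
Proof.
move=> gl g0; apply: contrapT => /not_orP[].
move=> /existsNP[x /not_implyP[axb /negP]]; rewrite -ltNge => gx.
move=> /existsNP[y /not_implyP[ayb /negP]]; rewrite -ltNge => gy.
have [xy|yx] := leP x y.
  have gxy : {within `[x, y], continuous g}.
    by apply/nonexpansive_continuous/(nonexpansive_sub _ _ gl); lra.
  have [|c] := @IVT _ g x y 0 xy gxy.
    by rewrite ge_min le_max (ltW gx) (ltW gy) orbT.
  rewrite in_itv/= => xcy gc.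
  have cx : c != x by apply/eqP => cx; move: gx; rewrite -cx gc ltxx.
  have cy : c != y by apply/eqP => cy; move: gy; rewrite -cy gc ltxx.
  by have /eqP := g0 c ltac:(lra).
have gxy : {within `[y, x], continuous g}.
  by apply/nonexpansive_continuous/(nonexpansive_sub _ _ gl); lra.
have [|c] := @IVT _ g y x 0 (ltW yx) gxy.
  by rewrite ge_min le_max (ltW gx) (ltW gy) orbT.
rewrite in_itv/= => xcy gc.
have cx : c != x by apply/eqP => cx; move: gx; rewrite -cx gc ltxx.
have cy : c != y by apply/eqP => cy; move: gy; rewrite -cy gc ltxx.
by have /eqP := g0 c ltac:(lra).
Qed.

(* [V] plays the role of the arc length [t |-> \int_0^t |f'|]. *)
Definition variation_of (R : realType) (a b : R) (f g V : R -> R) : Prop :=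
  forall x, a <= x <= b -> has_slope a b f x (g x) /\ has_slope a b V x `|g x|.

Section variation.
Context (R : realType).
Implicit Types (a b c p q : R) (f g V : R -> R).

Lemma variation_sub a b a' b' f g V : a' <= a -> b <= b' ->
  variation_of a' b' f g V -> variation_of a b f g V.
Proof.
move=> aa bb H x axb; have [|fx Vx] := H x; first by lra.
by split; [apply: has_slope_sub fx|apply: has_slope_sub Vx].
Qed.

Lemma variation_ge a b f g V : a <= b -> variation_of a b f g V ->
  `|f b - f a| <= V b - V a.
Proof.
move=> ab H; rewrite ler_norml; apply/andP; split.
  rewrite lerNl.
  have -> : - (f b - f a) = - f b - (- f a) by ring.
  apply: (@slope_le_increment _ _ _ (fun t => - f t) V (fun t => - g t)
    (fun t => `|g t|)) => // x axb.
  - exact/has_slopeN/(H _ axb).1.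
  - exact: (H _ axb).2.
  - by rewrite -normrN ler_norm.
apply: (@slope_le_increment _ _ _ f V g (fun t => `|g t|)) => // x axb.
- exact: (H _ axb).1.
- exact: (H _ axb).2.
- exact: ler_norm.
Qed.

Lemma variation_monotone a b f g V : a <= b -> variation_of a b f g V ->
  (forall x, a <= x <= b -> 0 <= g x) \/ (forall x, a <= x <= b -> g x <= 0) ->
  V b - V a <= `|f b - f a|.
Proof.
move=> ab H [g0|g0].
  apply: le_trans (ler_norm _).
  apply: (@slope_le_increment _ _ _ V f (fun t => `|g t|) g) => // x axb.
  - exact: (H _ axb).2.
  - exact: (H _ axb).1.
  - by rewrite ger0_norm// g0.
rewrite distrC; apply: le_trans (ler_norm _).
have -> : f a - f b = - f b - (- f a) by ring.
apply: (@slope_le_increment _ _ _ V (fun t => - f t) (fun t => `|g t|)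
  (fun t => - g t)) => // x axb.
- exact: (H _ axb).2.
- exact/has_slopeN/(H _ axb).1.
- by rewrite ler0_norm// g0.
Qed.

(** [V] is compared with an antiderivative of an affine bound on the speed: [u = 0] for constant
    speed, [u = 1/2] or [-1/2] for motion from or to rest. *)
Lemma variation_le_quadratic a b f g V c u v : a <= b ->
  variation_of a b f g V ->
  (forall x, a <= x <= b -> `|g x| <= 2 * u * (x - c) + v) ->
  V b - V a <= u * (b - c) ^+ 2 + v * b - (u * (a - c) ^+ 2 + v * a).
Proof.
move=> ab H gle.
have := @slope_le_increment _ a b V (fun t => u * (t - c) ^+ 2 + v * t + 0)
  (fun t => `|g t|) (fun t => 2 * u * (t - c) + v) ab.
rewrite !addr0; apply=> // x axb; first exact: (H _ axb).2.
exact: has_slope_quadratic.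
Qed.

Lemma variation_le_linear a b f g V c : a <= b -> variation_of a b f g V ->
  (forall x, a <= x <= b -> `|g x| <= c) -> V b - V a <= c * (b - a).
Proof.
move=> ab H gle; have := @variation_le_quadratic a b f g V 0 0 c ab H.
rewrite !mul0r !add0r -mulrBr; apply=> x axb.
by rewrite mulr0 mul0r add0r gle.
Qed.

Lemma variation_from_rest a b f g V : a <= b -> variation_of a b f g V ->
  nonexpansive_on a b g -> g a = 0 -> V b - V a <= (b - a) ^+ 2 / 2.
Proof.
move=> ab H gl ga.
have := @variation_le_quadratic a b f g V a 2^-1 0 ab H.
move=> /(_ _)/le_trans; apply; last by lra.
by move=> x axb; have := gl a x; rewrite ga subr0; lra.
Qed.

Lemma variation_to_rest a b f g V : a <= b -> variation_of a b f g V ->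
  nonexpansive_on a b g -> g b = 0 -> V b - V a <= (b - a) ^+ 2 / 2.
Proof.
move=> ab H gl gb.
have := @variation_le_quadratic a b f g V b (- 2^-1) 0 ab H.
move=> /(_ _)/le_trans; apply; last by lra.
by move=> x axb; have := gl x b; rewrite gb sub0r normrN; lra.
Qed.

Lemma variation_nonvanishing a b f g V : a <= b -> variation_of a b f g V ->
  nonexpansive_on a b g -> (forall x, a <= x <= b -> `|f x| <= 1) ->
  (forall x, a < x < b -> g x != 0) -> V b - V a <= 2.
Proof.
move=> ab H gl f1 g0.
apply: (le_trans (variation_monotone ab H (nonvanishing_sign gl g0))).
rewrite (le_trans (ler_normB _ _))//.
by have := f1 a; have := f1 b; lra.
Qed.

(* The two bounds [(b - a)^2 / 4] and [2] cross at [b - a = 2 * sqrt 2], where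
   both equal [(b - a) / sqrt 2]. *)
Lemma variation_bump a b f g V : a <= b -> variation_of a b f g V ->
  nonexpansive_on a b g -> (forall x, a <= x <= b -> `|f x| <= 1) ->
  g a = 0 -> g b = 0 -> (forall x, a < x < b -> g x != 0) ->
  V b - V a <= Num.sqrt 2 / 2 * (b - a).
Proof.
move=> ab H gl f1 ga gb g0.
have V2 := variation_nonvanishing ab H gl f1 g0.
(* Each half is estimated from its own end at rest, giving [d^2 / 8] twice. *)
pose m := (a + b) / 2.
have am : a <= m by rewrite /m; lra.
have mb : m <= b by rewrite /m; lra.
have := variation_from_rest am (variation_sub (lexx a) mb H)
  (nonexpansive_sub (lexx a) mb gl) ga.
have := variation_to_rest mb (variation_sub am (lexx b) H)
  (nonexpansive_sub am (lexx b) gl) gb.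
have s2 : Num.sqrt 2 ^+ 2 = 2 :> R by rewrite sqr_sqrtr.
have : 0 <= Num.sqrt 2 :> R by [].
move: s2 V2; set s := Num.sqrt 2.
rewrite (_ : b - m = (b - a) / 2) 1?(_ : m - a = (b - a) / 2); try by rewrite /m; field.
set d := b - a; have d0 : 0 <= d by rewrite /d; lra.
move=> s2 V2 s0 h1 h2.
have h : V b - V a <= d ^+ 2 / 4 by lra.
have [ds|ds] := leP d (2 * s); nra.
Qed.

(* Greedy induction: the zeros [l <= r] of [g] closest to [a + sqrt 2 / 2] on
   each side leave a short interval [[a, l]], on which [|g| <= sqrt 2 / 2], a
   zero-free interval [[l, r]], and a remainder shorter by [sqrt 2 / 2]. *)
Lemma variation_rest_to_rest n a b f g V : a <= b ->
  b - a <= n%:R * (Num.sqrt 2 / 2) -> variation_of a b f g V ->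
  nonexpansive_on a b g -> (forall x, a <= x <= b -> `|f x| <= 1) ->
  g a = 0 -> g b = 0 -> V b - V a <= Num.sqrt 2 / 2 * (b - a).
Proof.
set c := Num.sqrt 2 / 2.
have c0 : 0 < c by rewrite divr_gt0 ?sqrtr_gt0.
elim: n a => [|n IH] a ab ban H gl f1 ga gb.
  have -> : a = b by move: ban; rewrite mul0r; lra.
  by rewrite !subrr mulr0.
have short l : a <= l <= b -> l - a <= c -> V l - V a <= c * (l - a).
  move=> /andP[al lb] lc.
  apply: (variation_le_linear al (variation_sub (lexx a) lb H)) => x axl.
  by have := gl a x; rewrite ga subr0; lra.
have [bac|bac] := leP (b - a) c; first by apply: short => //; rewrite ab lexx.
have am : a <= a + c by lra.
have mb : a + c <= b by lra.
have [l [aml gl0 lm]] := last_zero am (nonexpansive_sub (lexx a) mb gl) ga.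
have [r [mrb gr0 mr]] := first_zero mb (nonexpansive_sub am (lexx b) gl) gb.
have al : a <= l by lra.
have lr : l <= r by lra.
have rb : r <= b by lra.
have ar : a <= r by lra.
have h1 := short l ltac:(lra) ltac:(lra).
have h2 : V r - V l <= c * (r - l).
  apply: (variation_bump lr (variation_sub al rb H) (nonexpansive_sub al rb gl))
    => // x lxr; first by apply: f1; lra.
  (* No zero lies strictly between [l] and [r]: [l] is the last one up to [a + c], and [r] the first
     one from there on. *)
  by have [xm|xm] := leP x (a + c); [apply: lm|apply: mr]; lra.
have h3 : V b - V r <= c * (b - r).
  apply: (IH r rb _ (variation_sub ar (lexx b) H)
    (nonexpansive_sub ar (lexx b) gl)) => //.
    by move: ban; rewrite -natr1 mulrDl mul1r; lra.
  by move=> x rxb; apply: f1; lra.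
nra.
Qed.

Lemma variation_le T f g V : 4 <= T -> variation_of 0 T f g V ->
  nonexpansive_on 0 T g -> (forall x, 0 <= x <= T -> `|f x| <= 1) ->
  V T - V 0 <= 4 + Num.sqrt 2 / 2 * (T - 4).
Proof.
move=> T4 H gl f1.
set c := Num.sqrt 2 / 2.
have s2 : Num.sqrt 2 ^+ 2 = 2 :> R by rewrite sqr_sqrtr.
have s0 : 0 <= Num.sqrt 2 :> R by [].
have c0 : 0 < c by rewrite divr_gt0 ?sqrtr_gt0.
have c1 : c <= 1 by rewrite /c; nra.
(* Without zeros [f] is monotone and its variation is at most 2. *)
have [[z [zT gz]]|noz] := pselect (exists z, 0 <= z <= T /\ g z = 0); last first.
  have : V T - V 0 <= 2; last by nra.
  apply: variation_nonvanishing H gl f1 _; first by lra.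
  by move=> x xT; apply/eqP => gx; apply: noz; exists x; split=> //; lra.
have z0 : 0 <= z by lra.
have zT' : z <= T by lra.
(* [a] and [b] are the first and last zeros on all of [[0, T]], possibly equal. Here [b] is a
   position; the final stretch has length [T - b]. *)
have [a [a0z ga fa]] := first_zero z0 (nonexpansive_sub (lexx 0) zT' gl) gz.
have [b [bzT gb lb]] := last_zero zT' (nonexpansive_sub z0 (lexx T) gl) gz.
have a0 : 0 <= a by lra.
have aT : a <= T by lra.
have ab : a <= b by lra.
have b0 : 0 <= b by lra.
have bT : b <= T by lra.
have start2 : V a - V 0 <= 2.
  apply: (variation_nonvanishing a0 (variation_sub (lexx 0) aT H)
    (nonexpansive_sub (lexx 0) aT gl)) => x xa; first by apply: f1; lra.
  by apply: fa; lra.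
have end2 : V T - V b <= 2.
  apply: (variation_nonvanishing bT (variation_sub b0 (lexx T) H)
    (nonexpansive_sub b0 (lexx T) gl)) => x xa; first by apply: f1; lra.
  by apply: lb; lra.
have starta := variation_to_rest a0 (variation_sub (lexx 0) aT H)
  (nonexpansive_sub (lexx 0) aT gl) ga.
have endb := variation_from_rest bT (variation_sub b0 (lexx T) H)
  (nonexpansive_sub b0 (lexx T) gl) gb.
have mid : V b - V a <= c * (b - a).
  (* Any natural number [n] with [b - a <= n * c] serves to bound the number of greedy steps. *)
  apply: (variation_rest_to_rest (n := (Num.truncn ((b - a) / c)).+1) ab _
    (variation_sub a0 bT H) (nonexpansive_sub a0 bT gl)) => //.
    by rewrite -ler_pdivrMr//; apply/ltW/truncnS_gt.
  by move=> x axb; apply: f1; lra.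
have starta' : V a - V 0 <= a.
  by have [|] := leP a 2; move: starta; nra.
have endb' : V T - V b <= T - b.
  by have [|] := leP (T - b) 2; move: endb; nra.
(* If the end stretches total at most 4, trading middle length (rate [c <= 1]) for end length (rate
   1) only raises the bound. Otherwise the ends give at most 4 and the middle is shorter than
   [T - 4]. *)
have [h|h] := leP (a + (T - b)) 4; nra.
Qed.

End variation.

(** * The upper bound *)

Lemma abs_continuous_on_sub (R : realType) (a b a' b' : R) (g : R -> R) :
  a' <= a -> b <= b' -> abs_continuous_on a' b' g -> abs_continuous_on a b g.
Proof.
move=> aa bb H e /H[d d0 Hd]; exists d => // n u v uv; apply: Hd => i.
by have := uv i; lra.
Qed.

Lemma L2class_nonexpansive (R : realType) (T : R) (f : R -> R) :
  L2class T f -> nonexpansive_on 0 T (deriv_on 0 T f).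
Proof.
move=> [_ gac _ gae] x y x0 xy yT.
pose g' := deriv_on 0 T (deriv_on 0 T f).
apply: (@ae_slope_lipschitz _ _ _ _ g' _ xy _ gae).
  exact: abs_continuous_on_sub gac.
move=> t xty /= /contrapT; rewrite in_itv/= => /(_ ltac:(lra))[dg lg].
by split=> //; apply: has_slope_sub (derivable_on_slope dg).
Qed.

Lemma nonexpansive_norm (R : realType) (a b : R) (g : R -> R) :
  nonexpansive_on a b g -> nonexpansive_on a b (fun t => `|g t|).
Proof.
by move=> gl x y ax xy yb; rewrite (le_trans (ler_dist_dist _ _))// gl.
Qed.

(** * Integrals of nonexpansive functions as antiderivatives *)

Section primitive.
Context (R : realType) (a b : R) (h : R -> R) (hl : nonexpansive_on a b h).
Notation mu := (@lebesgue_measure R).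

Let primitive t := \int[mu]_(x in `[a, t]) h x.

Let h_integrable t : t <= b -> mu.-integrable `[a, t] (EFin \o h).
Proof.
move=> tb; apply: continuous_compact_integrable; first exact: segment_compact.
exact/nonexpansive_continuous/(nonexpansive_sub _ _ hl).
Qed.

Lemma primitive_increment x y c d : a <= x -> x <= y -> y <= b ->
  (forall t, x <= t <= y -> c <= h t <= d) ->
  c * (y - x) <= primitive y - primitive x <= d * (y - x).
Proof.
move=> ax xy yb hcd.
have muxy : fine (mu `]x, y]%classic) = y - x.
  rewrite lebesgue_measure_itv/= lte_fin; case: ltP => //= yx.
  by apply/esym/eqP; rewrite subr_eq0 eq_le yx xy.
rewrite /primitive Rintegral_itvB ?bnd_simp//; last exact: h_integrable.
have ih : mu.-integrable `]x, y] (EFin \o h).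
  apply: integrableS (h_integrable yb) => //.
  by apply: subset_itvr; rewrite bnd_simp.
have ic k : mu.-integrable `]x, y] (EFin \o cst k).
  apply: (@integrableS _ _ _ mu `[x, y]) => //.
    by apply: subset_itvr; rewrite bnd_simp.
  apply: continuous_compact_integrable; first exact: segment_compact.
  by apply: continuous_subspaceT => t; exact: cvg_cst.
rewrite -muxy -!Rintegral_cst//; apply/andP; split.
- apply: (le_Rintegral _ (ic c) ih) => // t /=; rewrite in_itv/= => xty.
  by have /andP[] := hcd t ltac:(lra).
- apply: (le_Rintegral _ ih (ic d)) => // t /=; rewrite in_itv/= => xty.
  by have /andP[] := hcd t ltac:(lra).
Qed.

(** Between [x] and [y] the integrand stays within [|y - x|] of [h x], so the remainder is at most
    [(y - x)^2] and the radius can be [e] itself. *)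
Lemma primitive_slope x : a <= x <= b -> has_slope a b primitive x (h x).
Proof.
move=> /andP[ax xb] e e0; exists e => // y /andP[ay yb] yxe.
have [xy|/ltW yx] := leP x y.
  have := @primitive_increment x y (h x - (y - x)) (h x + (y - x)) ax xy yb.
  move=> /(_ _)/andP[t xty|lo hi].
    have := hl ax (proj1 (andP xty)) ltac:(lra).
    by rewrite ler_norml; lra.
  rewrite (ger0_norm (_ : 0 <= y - x)) in yxe *; last by lra.
  by rewrite ler_norml; nra.
have := @primitive_increment y x (h x - (x - y)) (h x + (x - y)) ay yx xb.
move=> /(_ _)/andP[t xty|lo hi].
  have := @hl t x ltac:(lra) ltac:(lra) xb.
  by rewrite ler_norml; lra.
rewrite (ler0_norm (_ : y - x <= 0)) in yxe *; last by lra.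
by rewrite ler_norml; nra.
Qed.

End primitive.

Lemma integral_primitive (R : realType) (a b : R) (h : R -> R) :
  nonexpansive_on a b h -> exists2 V : R -> R,
    forall x, a <= x <= b -> has_slope a b V x (h x) &
    (\int[@lebesgue_measure R]_(t in `[a, b]) (h t)%:E = (V b - V a)%:E)%E.
Proof.
move=> hl.
exists (fun t => \int[@lebesgue_measure R]_(x in `[a, t]) h x) => [x axb|].
  exact: primitive_slope.
have ih : (@lebesgue_measure R).-integrable `[a, b] (EFin \o h).
  apply: continuous_compact_integrable; first exact: segment_compact.
  exact: nonexpansive_continuous.
rewrite set_itv1 Rintegral_set1 subr0 /Rintegral fineK//.
exact: integrable_fin_num.
Qed.

Lemma L2class_variation (R : realType) (T : R) (f : R -> R) :
  L2class T f -> exists2 V : R -> R, variation_of 0 T f (deriv_on 0 T f) V &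
    (\int[@lebesgue_measure R]_(t in `[0%R, T]) (`|deriv_on 0 T f t|%R)%:E =
     (V T - V 0)%:E)%E.
Proof.
move=> fL; have gl := L2class_nonexpansive fL.
have [V slV intV] := integral_primitive (nonexpansive_norm gl).
exists V => // x xT; split; last exact: slV.
by apply: derivable_on_slope; case: fL => + _ _ _; apply; rewrite in_itv.
Qed.

Lemma sigma1_le (R : realType) (T : R) : 4 <= T ->
  (sigma1 T <= (4 + Num.sqrt 2 / 2 * (T - 4))%:E)%E.
Proof.
move=> T4; apply: ge_ereal_sup => _ [f fL <-].
have [V HV ->] := L2class_variation fL.
rewrite lee_fin (variation_le T4 HV (L2class_nonexpansive fL))// => x xT.
by case: fL => _ _ + _; apply; rewrite in_itv.
Qed.

(** * The extremal function *)

Definition glue (R : realType) (m : R) (f g : R -> R) (t : R) : R :=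
  if t <= m then f t else g t.

Lemma glue_le (R : realType) (m : R) (f g : R -> R) t :
  t <= m -> glue m f g t = f t.
Proof. by rewrite /glue => ->. Qed.

Lemma glue_ge (R : realType) (m : R) (f g : R -> R) t :
  f m = g m -> m <= t -> glue m f g t = g t.
Proof.
by move=> fg mt; rewrite /glue; case: leP => // tm; rewrite (_ : t = m)//; lra.
Qed.

(** Away from [m] the radius is cut down so that only one branch is seen; at [m] both branches share
    value and slope, and the smaller radius works. *)
Lemma has_slope_glue (R : realType) (a b m : R) (f g : R -> R) x l :
  f m = g m -> (x <= m -> has_slope a b f x l) ->
  (m <= x -> has_slope a b g x l) -> has_slope a b (glue m f g) x l.
Proof.
move=> fg Hf Hg e e0; have [xm|mx|xm] := ltgtP x m.
- have [d d0 H] := Hf (ltW xm) e e0.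
  exists (Num.min d (m - x)); first by rewrite lt_min d0 subr_gt0.
  move=> y ayb; rewrite lt_min => /andP[yd]; rewrite ltr_norml => ym.
  by rewrite !glue_le ?H//; lra.
- have [d d0 H] := Hg (ltW mx) e e0.
  exists (Num.min d (x - m)); first by rewrite lt_min d0 subr_gt0.
  move=> y ayb; rewrite lt_min => /andP[yd]; rewrite ltr_norml => ym.
  by rewrite !glue_ge ?H//; lra.
- rewrite -xm in fg Hf Hg *.
  have [d d0 H] := Hf (lexx x) e e0; have [d' d0' H'] := Hg (lexx x) e e0.
  exists (Num.min d d'); first by rewrite lt_min d0 d0'.
  move=> y ayb; rewrite lt_min => /andP[yd yd'].
  rewrite (glue_le f g (lexx x)); have [yx|/ltW xy] := leP y x.
    by rewrite glue_le// H.
  by rewrite glue_ge// fg H'.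
Qed.

Lemma nonexpansive_glue (R : realType) (a b m : R) (f g : R -> R) : f m = g m ->
  nonexpansive_on a b f -> nonexpansive_on a b g ->
  nonexpansive_on a b (glue m f g).
Proof.
move=> fg fl gl x y ax xy yb; have [ym|/ltW my] := leP y m.
  by rewrite !glue_le ?fl//; lra.
have [xm|/ltW mx] := leP x m; last by rewrite !glue_ge ?gl//; lra.
rewrite (glue_le f g xm) (glue_ge fg my).
rewrite (_ : g y - f x = g y - g m + (f m - f x)); last by rewrite fg; ring.
by rewrite (le_trans (ler_normD _ _))//; have := fl x m; have := gl m y; lra.
Qed.

Section wave.
Context (R : realType).
Implicit Types (k n : nat) (t : R).
Local Notation s := (Num.sqrt (2 : R)).

Let s2 : s ^+ 2 = 2. Proof. by rewrite sqr_sqrtr. Qed.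
Let s_ge0 : 0 <= s. Proof. by []. Qed.

(** Times at which the extremal function is at rest; the total time is [crest N + 2]. *)
Definition crest k : R := 2 + 2 * k%:R * s.

Lemma crestS k : crest k.+1 = crest k + 2 * s.
Proof. by rewrite /crest -natr1; ring. Qed.

Lemma crest_ge2 k : 2 <= crest k.
Proof. by rewrite /crest lerDl !mulr_ge0. Qed.

Lemma crest_le k n : (k <= n)%N -> crest k <= crest n.
Proof. by move=> kn; rewrite lerD2l ler_wpM2r// ler_wpM2l// ler_nat. Qed.

(** Parabola at rest at [crest k] with value [(-1)^k]. Consecutive arcs meet at the midpoint
    [crest k + s] of their crests, where both vanish with equal velocity. *)
Definition arc k t : R := (-1) ^+ k * (1 - (t - crest k) ^+ 2 / 2).
Definition arc' k t : R := (-1) ^+ k * (crest k - t).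

(** The first arc also covers the initial stretch and the last arc the final one, so [n + 1] arcs
    make the whole function. *)
Fixpoint wave n : R -> R :=
  if n is n'.+1 then glue (crest n' + s) (wave n') (arc n) else arc 0.
Fixpoint wave' n : R -> R :=
  if n is n'.+1 then glue (crest n' + s) (wave' n') (arc' n) else arc' 0.

Lemma arc_joint k : arc k (crest k + s) = arc k.+1 (crest k + s).
Proof.
rewrite /arc crestS (_ : _ - crest k = s); last by ring.
rewrite (_ : _ - (_ + 2 * s) = - s); last by ring.
by rewrite sqrrN s2 divff// subrr !mulr0.
Qed.

Lemma arc'_joint k : arc' k (crest k + s) = arc' k.+1 (crest k + s).
Proof. by rewrite /arc' crestS exprS; ring. Qed.

Lemma wave_joint n : wave n (crest n + s) = arc n (crest n + s).
Proof.
elim: n => //= n IH; rewrite glue_ge ?crestS//; last by have := s_ge0; lra.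
by rewrite IH arc_joint.
Qed.

Lemma wave'_joint n : wave' n (crest n + s) = arc' n (crest n + s).
Proof.
elim: n => //= n IH; rewrite glue_ge ?crestS//; last by have := s_ge0; lra.
by rewrite IH arc'_joint.
Qed.

Lemma wave_jointS n : wave n (crest n + s) = arc n.+1 (crest n + s).
Proof. by rewrite wave_joint arc_joint. Qed.

Lemma wave'_jointS n : wave' n (crest n + s) = arc' n.+1 (crest n + s).
Proof. by rewrite wave'_joint arc'_joint. Qed.

Lemma wave_ge n t : crest n <= t -> wave n t = arc n t.
Proof.
case: n => // n nt; rewrite /= glue_ge ?wave_jointS//.
by move: nt; rewrite crestS; have := s_ge0; lra.
Qed.

Lemma wave_le k n t : (k <= n)%N -> t <= crest k -> wave n t = wave k t.
Proof.
elim: n => [|n IH]; first by rewrite leqn0 => /eqP ->.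
rewrite leq_eqVlt => /predU1P[->//|]; rewrite ltnS => kn tk.
rewrite /= glue_le ?IH//.
by have := crest_le kn; have := s_ge0; lra.
Qed.

Lemma normr_sign k (x : R) : `|(-1) ^+ k * x| = `|x|.
Proof. by rewrite normrM normrX normrN1 expr1n mul1r. Qed.

Lemma arc_le1 k t : `|t - crest k| <= 2 -> `|arc k t| <= 1.
Proof.
rewrite normr_sign; set d := t - crest k => d2.
have : d ^+ 2 <= 2 ^+ 2 by rewrite -real_normK ?num_real// lerXn2r ?nnegrE.
by rewrite ler_norml; have := sqr_ge0 d; lra.
Qed.

Lemma wave_le1 n t : 0 <= t <= crest n + 2 -> `|wave n t| <= 1.
Proof.
(* Since [s <= 2], each joint is within distance 2 of the crests on both sides, as [arc_le1]
   requires. *)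
have := s_ge0; have s_le2 : s <= 2 by have := s2; have := s_ge0; nra.
move=> s0; elim: n => [|n IH] h.
  by apply: arc_le1; rewrite ler_norml; move: h; rewrite /crest !mulr0 mul0r; lra.
have [tn|nt] := leP t (crest n + s).
  by rewrite /= glue_le// IH//; lra.
rewrite /= glue_ge ?wave_jointS//; last exact: ltW.
by apply: arc_le1; rewrite ler_norml; move: h; rewrite crestS; lra.
Qed.

Lemma wave_crest n : wave n (crest n) = (-1) ^+ n.
Proof. by rewrite wave_ge// /arc subrr expr0n/= mul0r subr0 mulr1. Qed.

Lemma wave0 n : wave n 0 = -1.
Proof.
rewrite (wave_le (leq0n n)); last by have := crest_ge2 0; lra.
by rewrite /= /arc /crest; field.
Qed.

Lemma wave_end n : wave n (crest n + 2) = - (-1) ^+ n.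
Proof. by rewrite wave_ge ?lerDl// /arc; field. Qed.

Lemma arc_slope a b k t : has_slope a b (arc k) t (arc' k t).
Proof.
have := has_slope_quadratic a b (crest k) (- ((-1) ^+ k / 2)) 0 ((-1) ^+ k) t.
rewrite (_ : _ + 0 = arc' k t); last by rewrite /arc'; field.
by congr has_slope; apply/funext => u; rewrite /arc; field.
Qed.

Lemma arc'_slope a b k t : has_slope a b (arc' k) t (- (-1) ^+ k).
Proof.
have := has_slope_quadratic a b 0 0 (- (-1) ^+ k) ((-1) ^+ k * crest k) t.
rewrite mulr0 mul0r add0r.
by congr has_slope; apply/funext => u; rewrite /arc'; ring.
Qed.

Lemma wave_slope a b n t : has_slope a b (wave n) t (wave' n t).
Proof.
elim: n => [|n IH] /=; first exact: arc_slope.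
apply: has_slope_glue; first exact: wave_jointS.
- by move=> tn; rewrite glue_le.
- by move=> nt; rewrite glue_ge ?wave'_jointS//; exact: arc_slope.
Qed.

(** Off the joints the acceleration is locally constant, 1 or -1; it changes sign at the joints used
    by [wave n]. *)
Lemma wave'_slope a b n t : (forall k, t != crest k + s) ->
  exists2 l, `|l| <= 1 & has_slope a b (wave' n) t l.
Proof.
move=> tE; have sgn1 k : `|- (-1) ^+ k : R| <= 1.
  by rewrite normrN normrX normrN1 expr1n.
elim: n => [|n [l l1 IH]] /=; first by eexists; last exact: arc'_slope.
have := tE n; rewrite neq_lt => /orP[tn|nt].
  exists l => //; apply: has_slope_glue; first exact: wave'_jointS.
  - by [].
  - by rewrite leNgt tn.
exists (- (-1) ^+ n.+1) => //; apply: has_slope_glue; first exact: wave'_jointS.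
- by rewrite leNgt nt.
- by move=> _; exact: arc'_slope.
Qed.

Lemma wave'_nonexpansive a b n : nonexpansive_on a b (wave' n).
Proof.
have arcl k : nonexpansive_on a b (arc' k).
  move=> x y _ xy _; rewrite /arc' -mulrBr normr_sign ler_norml; lra.
by elim: n => //= n IH; apply: nonexpansive_glue => //; exact: wave'_jointS.
Qed.

End wave.

Lemma nonexpansive_abs_continuous (R : realType) (a b : R) (g : R -> R) :
  nonexpansive_on a b g -> abs_continuous_on a b g.
Proof.
move=> gl e e0; exists e => // n u v uv _; apply: le_lt_trans.
by apply: ler_sum => i _; have := uv i => -[/andP[] *]; exact: gl.
Qed.

Lemma has_slope_eq_on (R : realType) (a b : R) (f g : R -> R) x l :
  (forall t, a <= t <= b -> f t = g t) -> a <= x <= b ->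
  has_slope a b f x l -> has_slope a b g x l.
Proof.
move=> fg axb fl e /fl[d d0 H]; exists d => // y ayb.
by rewrite -!fg//; exact: H.
Qed.

Lemma wave_L2class (R : realType) n : L2class (crest R n + 2) (wave n).
Proof.
set T := crest R n + 2.
have T0 : 0 < T by have := crest_ge2 R n; rewrite /T; lra.
have dE t : 0 <= t <= T -> wave' n t = deriv_on 0 T (wave n) t.
  by move=> tT; apply/esym/slope_deriv_on => //; exact: wave_slope.
split.
- by move=> t _; apply: slope_derivable_on (wave_slope _ _ _ _).
- apply: nonexpansive_abs_continuous => x y x0 xy yT.
  by rewrite -!dE; [exact: (@wave'_nonexpansive R 0 T)|lra|lra].
- by move=> t; rewrite in_itv; exact: wave_le1.
(* The joints of all indices are discarded at once: they form a countable, hence null, set. *)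
- pose E := range (fun k => crest R k + Num.sqrt 2).
  have cE : countable E by exact: card_image_le.
  have nE : (@lebesgue_measure R).-negligible E.
    apply/negligibleP; last exact: countable_lebesgue_measure0.
    exact: countable_measurable.
  refine (negligibleS _ nE) => t; apply: contra_notP => tE /=; rewrite in_itv/= => tT.
  have [|l l1 tl] := @wave'_slope R 0 T n t.
    by move=> k; apply/eqP => tk; apply: tE; exists k.
  have tl' := has_slope_eq_on dE tT tl.
  by rewrite (slope_deriv_on T0 tT tl'); split=> //; exact: slope_derivable_on tl'.
Qed.

(** At time 0, at the crests and at the final time the values alternate between -1 and 1. Each of
    the [n + 2] stretches between these times contributes at least its displacement 2. *)
Lemma wave_variation_ge (R : realType) n (V : R -> R) :
  variation_of 0 (crest R n + 2) (wave n)
    (deriv_on 0 (crest R n + 2) (wave n)) V ->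
  2 * n%:R + 4 <= V (crest R n + 2) - V 0.
Proof.
set T := crest R n + 2; move=> HV.
have s0 : 0 <= Num.sqrt 2 :> R by [].
have step x y : 0 <= x -> x <= y -> y <= T -> `|wave n y - wave n x| <= V y - V x.
  by move=> x0 xy yT; apply: variation_ge xy (variation_sub x0 yT HV).
have swing k : `|(-1) ^+ k *+ 2| = 2 :> R.
  by rewrite normrMn normrX normrN1 expr1n.
have cn2 := crest_ge2 R n.
have up k : (k <= n)%N -> 2 * k%:R + 2 <= V (crest R k) - V 0.
  elim: k => [_|k IH kn].
    have cn0 := crest_le R (leq0n n); have c02 := crest_ge2 R 0.
    have := @step 0 (crest R 0) (lexx 0) ltac:(lra) ltac:(rewrite /T; lra).
    rewrite wave0 (wave_le (leq0n n))// wave_crest opprK -mulr2n (swing 0).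
    by rewrite mulr0 add0r.
  have cSn := crest_le R kn; have cS := crest_le R (leqnSn k).
  have ck := crest_ge2 R k.
  have := @step (crest R k) (crest R k.+1) ltac:(lra) cS ltac:(rewrite /T; lra).
  rewrite (wave_le kn)// (wave_le (ltnW kn))// !wave_crest exprS mulN1r -opprD.
  rewrite normrN -mulr2n swing; have := IH (ltnW kn); rewrite -natr1; lra.
have := @step (crest R n) T ltac:(lra) ltac:(rewrite /T; lra) (lexx T).
rewrite wave_crest wave_end -opprD normrN -mulr2n swing.
by have := up n (leqnn n); lra.
Qed.

Lemma sigma1_ge (R : realType) n :
  ((2 * n%:R + 4)%:E <= sigma1 (crest R n + 2))%E.
Proof.
have fL := @wave_L2class R n; have [V HV intV] := L2class_variation fL.
apply: le_ereal_sup_tmp; exists (V (crest R n + 2) - V 0)%:E.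
  by exists (wave n).
by rewrite lee_fin wave_variation_ge.
Qed.

Theorem proposition31 (R : realType) (N : nat) :
  sigma1 (2 * N%:R * Num.sqrt 2 + 4 : R) = (2 * N%:R + 4)%:E.
Proof.
have -> : 2 * N%:R * Num.sqrt 2 + 4 = crest R N + 2 by rewrite /crest; ring.
apply/eqP; rewrite eq_le sigma1_ge andbT.
have s2 : Num.sqrt 2 ^+ 2 = 2 :> R by rewrite sqr_sqrtr.
(* With [T - 4 = 2 N sqrt 2], the linear term of the upper bound is exactly [2 N]. *)
have -> : 2 * N%:R + 4 = 4 + Num.sqrt 2 / 2 * (crest R N + 2 - 4) :> R.
  rewrite (_ : _ * (crest R N + 2 - 4) = Num.sqrt 2 ^+ 2 * N%:R).
    by rewrite s2 addrC.
  by rewrite /crest; field.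
by apply: sigma1_le; have := crest_ge2 R N; lra.
Qed.
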